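(* On any fully-connected weighted $n$-node network (i.e., the communication graph $G$ is the complete graph $K_n$, with edge weights $w$), in the CONGEST model, single-source shortest paths can be solved exactly in $\tilde O(n^{1/2})$ rounds with high probability, and all-pairs shortest paths can be $(2+o(1))$-approximated in $\tilde O(n^{1/2})$ rounds with high probability (i.e., for every pair $u,v$ both $u$ and $v$ learn a value $\widetilde d(u,v)$ with $\mathrm{dist}_{G,w}(u,v)\le\widetilde d(u,v)\le(2+o(1))\,\mathrm{dist}_{G,w}(u,v)$).
   Context: CONGEST model: nodes have unique IDs in $\{1,\dots,\mathrm{poly}(n)\}$ and unbounded local computation; initially each node knows its ID, its neighbours' IDs and the weights of its incident edges; in each synchronous round every node may send a message of $O(\log n)$ bits along each incident edge. Edge weights are symmetric integers in $\{1,\dots,\mathrm{poly}(n)\}$ and do not affect communication. $\mathrm{dist}_{G,w}(u,v)$ is the weighted shortest-path distance. In SSSP a source $s$ (known to all) is given and each node $v$ must learn $\mathrm{dist}_{G,w}(s,v)$. ''With high probability'' means with probability at least $1-1/n^c$ for arbitrary constant $c$; $\tilde O$ hides $\mathrm{poly}\log n$ factors. *)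

(* Defs.v *)
From mathcomp Require Import all_boot all_order all_algebra.
From mathcomp Require Import all_classical all_reals all_analysis.
Import Order.TTheory GRing.Theory Num.Theory.
Import numFieldNormedType.Exports.

Set Implicit Arguments.
Unset Strict Implicit.
Unset Printing Implicit Defensive.

Local Open Scope classical_set_scope.
Local Open Scope ring_scope.

Definition poly_bounded (f : nat -> nat) : Prop :=
  exists C a : nat, forall n : nat, (0 < n)%N -> (f n <= C * n ^ a)%N.

(* Soft-O: f(n) = O(g(n) log^k n) for some constant k. *)
Definition softO (R : realType) (f g : nat -> R) : Prop :=
  exists k : nat,
    (f : nat -> R^o) =O_\oo (fun n : nat => g n * ln (n%:R : R) ^+ k : R^o).

(* The indices in 'I_n are names for the nodes used only by the model: an
   algorithm never sees them, it only sees the identifiers nid. *)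
Record network (n idmax wmax : nat) : Type := Network {
  adj : rel 'I_n;
  nid : 'I_n -> nat;
  wt : 'I_n -> 'I_n -> nat;
  adj_sym : symmetric adj;
  adj_irr : irreflexive adj;
  nid_inj : injective nid;
  nid_bound : forall v, (1 <= nid v <= idmax)%N;
  wt_sym : forall u v, adj u v -> wt u v = wt v u;
  wt_bound : forall u v, adj u v -> (1 <= wt u v <= wmax)%N
}.

Definition fully_connected (n idmax wmax : nat) (N : network n idmax wmax) :=
  forall u v : 'I_n, adj N u v = (u != v).

Section Distance.
Variables (R : realType) (n idmax wmax : nat) (N : network n idmax wmax).

Fixpoint walk_weight (u : 'I_n) (p : seq 'I_n) : nat :=
  if p is v :: q then (wt N u v + walk_weight v q)%N else 0%N.

(* The walk u :: p goes from u to last u p; dist is +oo when v is not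
   reachable from u. *)
Definition dist (u v : 'I_n) : \bar R :=
  ereal_inf [set ((walk_weight u p)%:R)%:E |
             p in [set p : seq 'I_n | path (adj N) u p /\ last u p = v]].

End Distance.

(* A synchronous message-passing algorithm with at most B bits per message and
   unrestricted local computation. A node starts from its own identifier, the
   partial function mapping each neighbour's identifier to the weight of the
   connecting edge, an input x : X common to all nodes, and a private random
   bit string. In each round it emits an optional message for each neighbour
   (addressed by identifier), then updates its state from the messages received
   (indexed by the sender's identifier). *)
Record algorithm (X O : Type) (B : nat) : Type := Algorithm {
  state : Type;
  rbits : nat;
  init : nat -> (nat -> option nat) -> X -> rbits.-tuple bool -> state;
  send : state -> nat -> option (B.-bseq bool);
  recv : state -> (nat -> option (B.-bseq bool)) -> state;
  output : state -> O
}.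

(* CONGEST: one algorithm for each n, with messages of beta * ceil(log_2 n)
   bits. The dependence on n gives the nodes no extra information on a fully
   connected network, where n is one more than the degree. *)
Definition congest_algorithm (X O : Type) (beta : nat) : Type :=
  forall n : nat, algorithm X O (beta * up_log 2 n).

Section Execution.
Variables (n idmax wmax : nat) (N : network n idmax wmax).
Variables (X O : Type) (B : nat) (A : algorithm X O B).

Definition coins := {ffun 'I_n -> (rbits A).-tuple bool}.

Definition neighbour (v : 'I_n) (i : nat) : option 'I_n :=
  [pick u | adj N v u && (nid N u == i)].

Definition local_weights (v : 'I_n) (i : nat) : option nat :=
  omap (wt N v) (neighbour v i).

Definition start (x : X) (r : coins) (v : 'I_n) : state A :=
  init (nid N v) (local_weights v) x (r v).

Definition round (st : 'I_n -> state A) (v : 'I_n) : state A :=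
  recv (st v) (fun i =>
    if neighbour v i is Some u then send (st u) (nid N v) else None).

Definition run (x : X) (T : nat) (r : coins) (v : 'I_n) : O :=
  output (iter T round (start x r) v).

End Execution.

(* Probability of an event under uniform and independent coins. *)
Definition Pr (R : realType) (Omega : finType) (E : Omega -> Prop) : R :=
  #|[pred r | `[< E r >]]|%:R / #|Omega|%:R.

Section Problems.
Variables (R : realType) (n idmax wmax : nat) (N : network n idmax wmax).

Definition solves_SSSP (s : 'I_n) (out : 'I_n -> nat) : Prop :=
  forall v : 'I_n, ((out v)%:R)%:E = dist R N s v.

(* out v i is the value that v outputs for the node with identifier i. *)
Definition approximates_APSP (alpha : R) (out : 'I_n -> nat -> R) : Prop :=
  exists d : 'I_n -> 'I_n -> R, forall u v : 'I_n,
    [/\ out u (nid N v) = d u v, out v (nid N u) = d u v,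
        (dist R N u v <= (d u v)%:E)%E &
        ((d u v)%:E <= alpha%:E * dist R N u v)%E].

End Problems.

(* Main.v *)
Require Import Defs.
From Stdlib Require Import PeanoNat.
From mathcomp Require Import all_boot all_order all_algebra.
From mathcomp Require Import all_classical all_reals all_analysis.
From mathcomp Require Import zify ring lra.
Import Order.TTheory GRing.Theory Num.Theory.
Import numFieldNormedType.Exports.

Set Implicit Arguments.
Unset Strict Implicit.
Unset Printing Implicit Defensive.

(** All distances are computed exactly and deterministically, by squaring the
    weight matrix D about log n times in the (min, +) semiring. The node v holds
    row v of D, which by symmetry is also its column v. Put m = floor (sqrt n),
    rank the nodes by identifier, and split the ranks into m classes modulo m of
    at most m + 2 elements each. One node is in charge of each of the m * m
    blocks of the product. Node l sends D(l, i), for i in the two classes of a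
    block, to the node in charge of that block; this node then knows D(i, l) and
    D(l, j) for all l, so it computes the block and returns its rows to their
    owners. Every link carries O(sqrt n) numbers per squaring, without any
    routing. *)

(** * Minima over finite lists of naturals *)

Section MinSeq.
Local Open Scope nat_scope.

(** The seed [F x] stands in for an infinite default; it is harmless whenever [x] belongs to [s]. *)
Definition minseq (I : Type) (F : I -> nat) (x : I) (s : seq I) : nat :=
  foldr (fun i => minn (F i)) (F x) s.

Lemma minseq_le (I : eqType) (F : I -> nat) x s i :
  i \in s -> minseq F x s <= F i.
Proof.
elim: s => //= j s IH; rewrite in_cons => /predU1P[->|/IH]; first exact: geq_minl.
exact: leq_trans (geq_minr _ _).
Qed.

Lemma minseq_eq_exists (I : eqType) (F : I -> nat) x s :
  x \in s -> exists2 i, i \in s & minseq F x s = F i.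
Proof.
move=> xs; suff [i] : exists2 i, i \in x :: s & minseq F x s = F i.
  by rewrite in_cons => /predU1P[->|is_] ->; [exists x | exists i].
elim: s {xs} => [|j s [i]] /=; first by exists x; rewrite ?mem_head.
rewrite in_cons => i_s ->; rewrite /minn; case: ifP => _; last exists i => //.
  by exists j; rewrite // !in_cons eqxx orbT.
by case/orP: i_s => h; rewrite !in_cons h ?orbT.
Qed.

Lemma minseq_map (I J : eqType) (h : I -> J) (F : I -> nat) (G : J -> nat) x y
    (s : seq I) (s' : seq J) :
    x \in s -> y \in s' -> s' =i [seq h i | i <- s] ->
    {in s, forall i, G (h i) = F i} ->
  minseq G y s' = minseq F x s.
Proof.
move=> xs ys' s'E GF; apply/eqP; rewrite eqn_leq; apply/andP; split.
  have [i si ->] := minseq_eq_exists F xs.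
  by rewrite -GF // minseq_le // s'E map_f.
have [j] := minseq_eq_exists G ys'.
by rewrite s'E => /mapP[i si ->] ->; rewrite GF // minseq_le.
Qed.

End MinSeq.

(** * Min-plus squarings of the weight matrix and weighted distances *)

Section MinPlus.
Local Open Scope nat_scope.
Variables (n idmax wmax : nat) (N : network n idmax wmax).

(** Both summands start from [l], so the product is written with the row that [l] holds and can
    send. *)
Fixpoint mpdist (t : nat) (u v : 'I_n) : nat :=
  if t is t'.+1 then
    minseq (fun l => mpdist t' l u + mpdist t' l v) u (enum 'I_n)
  else if u == v then 0 else wt N u v.

Hypothesis fcN : fully_connected N.

Lemma mpdistS_le t u v l : mpdist t.+1 u v <= mpdist t l u + mpdist t l v.
Proof.
exact: (@minseq_le _ (fun l => mpdist t l u + mpdist t l v)) (mem_enum _ _).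
Qed.

Lemma mpdistS_exists t u v :
  exists l, mpdist t.+1 u v = mpdist t l u + mpdist t l v.
Proof.
have uI : u \in enum 'I_n by rewrite mem_enum.
have [l _ lE] := minseq_eq_exists (fun l => mpdist t l u + mpdist t l v) uI.
by exists l.
Qed.

Lemma mpdist_sym t u v : mpdist t u v = mpdist t v u.
Proof.
case: t => [|t] /=; last first.
  have le x y : mpdist t.+1 x y <= mpdist t.+1 y x.
    by have [l ->] := mpdistS_exists t y x; rewrite addnC mpdistS_le.
  by apply/eqP; rewrite eqn_leq !le.
rewrite eq_sym; case: eqVneq => // vu; apply: wt_sym.
by rewrite fcN eq_sym.
Qed.

Lemma mpdist_diag t u : mpdist t u u = 0.
Proof.
elim: t => [|t IH]; first by rewrite /= eqxx.
by apply/eqP; rewrite -leqn0 (leq_trans (mpdistS_le t u u u)) ?IH.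
Qed.

(** The choice [l = u] shows that entries never grow with [t]. In a complete graph single edge
    weights thus bound them all, and one message width serves every squaring. *)
Lemma mpdist_bound t u v : mpdist t u v <= wmax.
Proof.
elim: t => [|t IH] /=.
  case: eqVneq => // uv.
  by have /andP[] : 1 <= wt N u v <= wmax by apply: wt_bound; rewrite fcN.
by apply: leq_trans (mpdistS_le t u v u) _; rewrite mpdist_diag.
Qed.

Lemma walk_weight_cat u p q :
  walk_weight N u (p ++ q) = walk_weight N u p + walk_weight N (last u p) q.
Proof. by elim: p u => //= x p IH u; rewrite IH addnA. Qed.

Lemma mpdist_walk t u v : exists2 p,
  path (adj N) u p /\ last u p = v & walk_weight N u p = mpdist t u v.
Proof.
elim: t u v => [|t IH] u v.
  rewrite /=; case: eqVneq => [->|uv]; first by exists [::].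
  by exists [:: v]; rewrite /= ?fcN ?uv ?addn0.
have [l ->] := mpdistS_exists t u v.
have [p [pp <-] <-] := IH l v; rewrite (mpdist_sym t l).
have [q [qp lq] <-] := IH u l.
by exists (q ++ p); rewrite ?walk_weight_cat ?last_cat ?cat_path lq // qp pp.
Qed.

(** Cutting the walk after [2 ^ t] edges leaves two pieces covered by induction. *)
Lemma mpdist_le_short_walk t u p : path (adj N) u p -> size p <= 2 ^ t ->
  mpdist t u (last u p) <= walk_weight N u p.
Proof.
elim: t u p => [|t IH] u p.
  case: p => [|x [|y p]] //=; first by rewrite eqxx.
  by rewrite fcN andbT addn0 => /negPf ->.
rewrite -{1 3 4}(cat_take_drop (2 ^ t) p) cat_path => /andP[p1 p2] sp.
rewrite last_cat walk_weight_cat.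
apply: leq_trans (mpdistS_le t _ _ (last u (take (2 ^ t) p))) _.
rewrite mpdist_sym leq_add // IH //.
  by rewrite size_take_min geq_minl.
by rewrite size_drop leq_subLR addnn -mul2n -expnS.
Qed.

(** Simplify the tail first; if [u] occurs in it, keep only what follows that occurrence. *)
Lemma simple_walk u p : path (adj N) u p -> exists q,
  [/\ path (adj N) u q, last u q = last u p, uniq (u :: q) &
      walk_weight N u q <= walk_weight N u p].
Proof.
elim: p u => [|v p IH] u /=; first by exists [::].
case/andP=> uv /IH[q [qp lq uq wq]].
have [uin|unin] := boolP (u \in v :: q); last first.
  exists (v :: q).
  by split; [rewrite /= uv | | rewrite cons_uniq unin | rewrite leq_add2l].
move: uin uq qp lq wq; rewrite in_cons => /predU1P[<-|].
  by move=> uq qp lq wq; exists q; split=> //; rewrite (leq_trans wq) ?leq_addl.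
case/splitPr=> a b; rewrite cat_path last_cat /=.
move=> uq /and3P[_ _ bp] lb wq; exists b; split=> //.
  by move: uq; rewrite cat_uniq /= => /and4P[_ _ _ ->].
apply: leq_trans (leq_addl _ _); apply: leq_trans wq.
by rewrite walk_weight_cat /= addnA leq_addl.
Qed.

(** A walk without repeated vertices has fewer than [n] edges. *)
Lemma mpdist_le_walk t u p : n <= 2 ^ t -> path (adj N) u p ->
  mpdist t u (last u p) <= walk_weight N u p.
Proof.
move=> nt /simple_walk[q [qp <- uq wq]]; apply: leq_trans wq.
apply: mpdist_le_short_walk => //; apply: leq_trans nt.
by have := max_card (mem (u :: q)); rewrite (card_uniqP uq) card_ord => /ltnW.
Qed.

Lemma mpdist_dist (R : realType) t u v : n <= 2 ^ t ->
  (((mpdist t u v)%:R)%:E)%R = dist R N u v.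
Proof.
move=> nt; apply/eqP; rewrite eq_le; apply/andP; split.
  apply: le_ereal_inf_tmp => _ [p [pp <-] <-].
  by rewrite lee_fin ler_nat mpdist_le_walk.
apply: ereal_inf_lbound; have [p pP pE] := mpdist_walk t u v.
by exists p; rewrite ?pE.
Qed.

End MinPlus.

(** * Fixed-width binary messages *)

Section Encoding.
Local Open Scope nat_scope.

Fixpoint bits (B x : nat) : seq bool :=
  if B is B'.+1 then odd x :: bits B' x./2 else [::].

Fixpoint bits_value (s : seq bool) : nat :=
  if s is b :: s' then b + (bits_value s').*2 else 0.

Lemma size_bits B x : size (bits B x) = B.
Proof. by elim: B x => //= B IH x; rewrite IH. Qed.

Lemma bitsK B x : x < 2 ^ B -> bits_value (bits B x) = x.
Proof.
elim: B x => [|B IH] x /=; first by case: x.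
move=> xB; rewrite IH ?odd_double_half // -ltn_double -[(2 ^ B).*2]mul2n -expnS.
by apply: leq_ltn_trans xB; rewrite -{2}(odd_double_half x) leq_addl.
Qed.

Definition encode B x : B.-bseq bool := Bseq (eq_leq (size_bits B x)).

End Encoding.

(* In an exchange, every node sends G numbers to every other node, one per
   round; the second component of a state buffers the rounds of the current
   exchange. *)
Section Exchange.
Local Open Scope nat_scope.
Variables (X O S : Type) (B G : nat).
Variables (pinit : nat -> (nat -> option nat) -> S).
Variables (psend : S -> nat -> nat -> nat).
Variables (precv : S -> (nat -> nat -> nat) -> S).
Variable pout : X -> S -> O.

(** The buffer length is the round counter: it selects the number to send and, on reaching [G],
    triggers [precv]. There are no random bits. *)
Definition exchange_algorithm : algorithm X O B :=
  @Algorithm X O B (X * (S * seq (nat -> nat))) 0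
    (fun own w x _ => (x, (pinit own w, [::])))
    (fun st dst => Some (encode B (psend st.2.1 dst (size st.2.2))))
    (fun st inc =>
       let buf := rcons st.2.2 (fun i => oapp (bits_value \o val) 0 (inc i)) in
       (st.1, if size buf == G
              then (precv st.2.1 (fun i a => nth (fun=> 0) buf a i), [::])
              else (st.2.1, buf)))
    (fun st => pout st.1 st.2.1).

Variables (n idmax wmax : nat) (N : network n idmax wmax).

Definition received (st : 'I_n -> S) v i a : nat :=
  if neighbour N v i is Some u
  then bits_value (bits B (psend (st u) (nid N v) a)) else 0.

Definition exchange (st : 'I_n -> S) (v : 'I_n) : S :=
  precv (st v) (fun i a => if a < G then received st v i a else 0).

(** All numbers of an exchange are computed from the state at its start, since only the buffer
    changes. The bound is strict because round [G] empties the buffer. *)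
Lemma iter_round_partial x st k : k < G ->
  iter k (@round _ _ _ N _ _ _ exchange_algorithm) (fun v => (x, (st v, [::]))) =
  fun v => (x, (st v, mkseq (fun a i => received st v i a) k)).
Proof.
elim: k => // k IH kG; rewrite iterS IH ?(ltnW kG) //.
apply/funext => v; rewrite /round /= size_rcons size_mkseq ltn_eqF //.
congr (_, (_, _)); rewrite /mkseq -addn1 iotaD map_cat cats1; congr rcons.
apply/funext => i; rewrite /received; case: neighbour => //= u.
by rewrite size_map size_iota.
Qed.

Lemma iter_round_exchange x st t : 0 < G ->
  iter (t * G) (@round _ _ _ N _ _ _ exchange_algorithm)
    (fun v => (x, (st v, [::]))) =
  fun v => (x, (iter t exchange st v, [::])).
Proof.
move=> G0; elim: t => // t IH; rewrite mulSn iterD IH.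
rewrite -{1}(prednK G0) iterS iter_round_partial ?prednK //.
apply/funext => v; rewrite /round /= size_rcons size_mkseq prednK // eqxx.
congr (_, (_, _)); rewrite /exchange; congr precv.
apply/funext => i; apply/funext => a; rewrite nth_rcons size_mkseq.
(* Earlier rounds, indices beyond the buffer (default 0), and the number received in the last
   round. *)
case: (ltngtP a G.-1) => [aG|Ga|->].
- by rewrite nth_mkseq // ifT //; lia.
- by rewrite ifF //; lia.
rewrite prednK // leqnn.
by rewrite /received; case: neighbour => //= u; rewrite size_mkseq.
Qed.

Lemma run_exchange x t r v : 0 < G ->
  run N x (t * G) (r : coins n exchange_algorithm) v =
  pout x (iter t exchange (fun u => pinit (nid N u) (local_weights N u)) v).
Proof. by move=> G0; rewrite /run iter_round_exchange. Qed.

End Exchange.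

(* The node of rank [p * m + q] computes the block of the min-plus square whose
   rows and columns have ranks congruent modulo [m] to [p] and [q]. *)
Section Squaring.
Local Open Scope nat_scope.

Record mpstate := MPState {
  own : nat;
  ids : seq nat;
  squaring : bool; (* the block is known and has to be returned *)
  entry : nat -> nat;
  block : nat -> nat -> nat
}.

Variable m : nat.

(** The ranks congruent to [p] modulo [m] are the [p + m * a]. *)
Definition group_member (L : seq nat) (p a : nat) := nth 0 L (p + m * a).

(** In a complete graph [own] and the identifiers with a weight are all identifiers, so every node
    builds the same increasing list and ranks agree. *)
Definition mpinit (M own : nat) (w : nat -> option nat) : mpstate :=
  MPState own [seq i <- iota 0 M.+1 | (i == own) || w i] false
    (fun i => if i == own then 0 else odflt 0 (w i)) (fun _ _ => 0).

(** When rows are sent, the first [m + 2] slots serve the row class of the receiver's block, the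
    next [m + 2] its column class. *)
Definition mpsend (s : mpstate) (dst a : nat) : nat :=
  if squaring s then
    block s dst (group_member (ids s) (index (own s) (ids s) %% m) a)
  else
    let r := index dst (ids s) in
    entry s (if a < m.+2 then group_member (ids s) (r %/ m) a
           else group_member (ids s) (r %% m) (a - m.+2)).

(** No link joins a node to itself, so [inc'] recomputes the node's own contribution. *)
Definition mprecv (s : mpstate) (inc : nat -> nat -> nat) : mpstate :=
  let inc' i a := if i == own s then mpsend s i a else inc i a in
  let rk i := index i (ids s) in
  if squaring s then
    MPState (own s) (ids s) false
      (fun j => inc' (nth 0 (ids s) (rk (own s) %% m * m + rk j %% m))
                     (rk j %/ m))
      (block s)
  else
    MPState (own s) (ids s) true (entry s)
      (fun i j => minseq (fun l => inc' l (rk i %/ m) + inc' l (m.+2 + rk j %/ m))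
                    (own s) (ids s)).

Variables (n idmax wmax : nat) (N : network n idmax wmax).
Hypothesis fcN : fully_connected N.
Variable B : nat.
Hypothesis wB : wmax < 2 ^ B.
Hypothesis m_gt0 : 0 < m.
Hypothesis m_floor : m * m <= n.
Hypothesis m_ceil : n < m.+1 * m.+1.

Definition node_ids := [seq i <- iota 0 idmax.+1 | i \in codom (nid N)].

Lemma mem_node_ids i : (i \in node_ids) = (i \in codom (nid N)).
Proof.
rewrite mem_filter mem_iota andb_idr // => /codomP[u ->].
by rewrite add0n ltnS; case/andP: (nid_bound N u).
Qed.

Lemma nid_node_ids u : nid N u \in node_ids.
Proof. by rewrite mem_node_ids codom_f. Qed.

Lemma uniq_node_ids : uniq node_ids.
Proof. by rewrite filter_uniq ?iota_uniq. Qed.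

Lemma size_node_ids : size node_ids = n.
Proof.
rewrite -[RHS]card_ord -(size_codom (nid N)).
apply/perm_size/uniq_perm; [exact: uniq_node_ids| |exact: mem_node_ids].
by rewrite map_inj_uniq ?enum_uniq //; apply: nid_inj.
Qed.

Definition rank u := index (nid N u) node_ids.

Lemma rank_lt u : rank u < n.
Proof. by rewrite -[X in _ < X]size_node_ids index_mem nid_node_ids. Qed.

Lemma rank_surj r : r < n -> exists2 u, rank u = r & nid N u = nth 0 node_ids r.
Proof.
move=> r_lt; have rn : r < size node_ids by rewrite size_node_ids.
have /[!mem_node_ids]/codomP[u uE] := mem_nth 0 rn.
by exists u; rewrite // /rank -uE index_uniq ?uniq_node_ids.
Qed.

(** Since [n <= m * (m + 2)], each class has at most [m + 2] members; hence the slot counts. *)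
Lemma rank_div_lt u : rank u %/ m < m.+2.
Proof.
rewrite ltn_divLR //; apply: leq_trans (rank_lt u) _.
by move: m_ceil; nia.
Qed.

Lemma group_member_rank u :
  group_member node_ids (rank u %% m) (rank u %/ m) = nid N u.
Proof. by rewrite /group_member addnC mulnC -divn_eq nth_index ?nid_node_ids. Qed.

Lemma neighbour_nid u v : u != v -> neighbour N v (nid N u) = Some u.
Proof.
move=> uv; rewrite /neighbour; case: pickP => [x /andP[_ /eqP/nid_inj ->] //|].
by move=> /(_ u); rewrite fcN eq_sym uv eqxx.
Qed.

Lemma local_weights_nid v i :
  (i == nid N v) || local_weights N v i = (i \in codom (nid N)).
Proof.
apply/idP/idP => [/predU1P[->|]|/codomP[u ->]]; first exact: codom_f.
  rewrite /local_weights /neighbour; case: pickP => //= u /andP[_ /eqP <-] _.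
  exact: codom_f.
case: (eqVneq u v) => [->|uv]; first by rewrite eqxx.
by rewrite /local_weights neighbour_nid // orbT.
Qed.

Definition holds_mpdist (t : nat) (st : 'I_n -> mpstate) : Prop :=
  forall v, [/\ own (st v) = nid N v, ids (st v) = node_ids,
    squaring (st v) = false &
    forall u, entry (st v) (nid N u) = mpdist N t v u].

(** Vacuous for a node of rank at least [m * m], which has no block: [rank v %/ m] is then no
    residue modulo [m]. *)
Definition holds_mpblock (t : nat) (st : 'I_n -> mpstate) : Prop :=
  forall v, [/\ own (st v) = nid N v, ids (st v) = node_ids,
    squaring (st v) = true &
    forall i j, rank i %% m = rank v %/ m -> rank j %% m = rank v %% m ->
      block (st v) (nid N i) (nid N j) = mpdist N t i j].

Lemma holds_mpinit :
  holds_mpdist 0 (fun v => mpinit idmax (nid N v) (local_weights N v)).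
Proof.
move=> v; split=> // [|u].
  by apply: eq_filter => i; rewrite local_weights_nid.
rewrite /=.
rewrite (inj_eq (@nid_inj _ _ _ N)) eq_sym; case: eqVneq => // uv.
by rewrite /local_weights neighbour_nid // eq_sym.
Qed.

Local Notation exch := (@exchange _ B (m.+2).*2 mpsend mprecv _ _ _ N).

Lemma received_nid (st : 'I_n -> mpstate) u v a :
  mpsend (st u) (nid N v) a < 2 ^ B -> a < (m.+2).*2 ->
  (if nid N u == nid N v then mpsend (st v) (nid N u) a
   else if a < (m.+2).*2 then received B mpsend N st v (nid N u) a else 0) =
  mpsend (st u) (nid N v) a.
Proof.
move=> sB aG; rewrite aG (inj_eq (@nid_inj _ _ _ N)).
case: eqVneq => [->//|uv].
by rewrite /received neighbour_nid // bitsK.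
Qed.

Lemma mpdist_ltB t u v : mpdist N t u v < 2 ^ B.
Proof. exact: leq_ltn_trans (mpdist_bound fcN t u v) wB. Qed.

Lemma exchange_rows t st : holds_mpdist t st -> holds_mpblock t.+1 (exch st).
Proof.
move=> H v; have [ov iv sv rv] := H v.
rewrite /exchange /mprecv sv /= ov iv; split=> // i j ri rj.
(* [sendE] reads the slots of the row class, [sendE'] those of the column class, shifted by
   [m + 2]. *)
have sendE l w : rank w %% m = rank v %/ m ->
    mpsend (st l) (nid N v) (rank w %/ m) = mpdist N t l w.
  move=> rw; have [_ il sl rl] := H l.
  by rewrite /mpsend sl il -/(rank v) rank_div_lt -rw group_member_rank rl.
have sendE' l w : rank w %% m = rank v %% m ->
    mpsend (st l) (nid N v) (m.+2 + rank w %/ m) = mpdist N t l w.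
  move=> rw; have [_ il sl rl] := H l.
  rewrite /mpsend sl il -/(rank v) ltnNge leq_addr /= addKn -rw.
  by rewrite group_member_rank rl.
have aG := rank_div_lt.
(* The nodes minimize over identifiers, [mpdist] over node names. *)
apply: (@minseq_map _ _ (nid N)); rewrite ?mem_enum ?nid_node_ids //.
  by move=> x; rewrite mem_node_ids.
move=> l _; rewrite -/(rank i) -/(rank j).
rewrite !received_nid ?(sendE' l j) ?(sendE l i) ?mpdist_ltB //.
  by have := aG j; lia.
by have := aG i; lia.
Qed.

Lemma exchange_blocks t st : holds_mpblock t st -> holds_mpdist t (exch st).
Proof.
move=> H v; have [ov iv sv bv] := H v.
rewrite /exchange /mprecv sv /= ov iv; split=> // j.
rewrite -/(rank v) -/(rank j).
(* [r] is the rank of the node in charge of the block with [v] among its rows and [j] among its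
   columns; it exists because [m * m <= n]. *)
set r := _ + _; have r_lt : r < m * m.
  have := ltn_pmod (rank v) m_gt0; have := ltn_pmod (rank j) m_gt0.
  rewrite /r; nia.
have [w rw wE] := rank_surj (leq_trans r_lt m_floor).
have [ow iw sw bw] := H w.
have rwd : rank w %/ m = rank v %% m.
  by rewrite rw /r divnMDl // divn_small ?addn0 ?ltn_pmod.
have rwm : rank w %% m = rank j %% m by rewrite rw /r modnMDl modn_mod.
have sE : mpsend (st w) (nid N v) (rank j %/ m) = mpdist N t v j.
  by rewrite /mpsend sw ow iw -/(rank w) rwm group_member_rank bw.
have jG := rank_div_lt j.
rewrite -wE received_nid ?sE ?mpdist_ltB //; lia.
Qed.

Lemma iter_exchange_mpdist t : holds_mpdist t
  (iter t.*2 exch (fun v => mpinit idmax (nid N v) (local_weights N v))).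
Proof.
elim: t => [|t IH]; first exact: holds_mpinit.
by rewrite doubleS !iterS; apply/exchange_blocks/exchange_rows.
Qed.

End Squaring.

(** * Probability and round bounds *)

Section Bounds.
Local Open Scope ring_scope.
Variable R : realType.

Lemma Pr_ge0 (Omega : finType) (E : Omega -> Prop) : 0 <= Pr R E.
Proof. by rewrite divr_ge0 ?ler0n. Qed.

Lemma Pr_certain (Omega : finType) (E : Omega -> Prop) (w : Omega) :
  (forall r, E r) -> Pr R E = 1.
Proof.
move=> allE; have w_gt0 : (0 < #|Omega|)%N by apply/card_gt0P; exists w.
rewrite /Pr (eq_card (B := Omega)) ?divff ?pnatr_eq0 -?lt0n // => r.
by rewrite !inE; apply/asboolP.
Qed.

(** For [n = 1] the bound is 0, which disposes of the size at which messages have no bits. *)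
Lemma Pr_whp (Omega : finType) (E : Omega -> Prop) (w : Omega) (n c : nat) :
    (0 < n)%N -> ((1 < n)%N -> forall r, E r) ->
  1 - ((n%:R : R) ^+ c)^-1 <= Pr R E.
Proof.
case: n => [|[|n]] // _ allE; first by rewrite expr1n invr1 subrr Pr_ge0.
by rewrite (Pr_certain w (allE isT)) gerBl invr_ge0 exprn_ge0.
Qed.

(** Two exchanges for each of [up_log 2 n] squarings. *)
Definition apsp_rounds (n : nat) : nat :=
  ((up_log 2 n).*2 * ((Nat.sqrt n).+2).*2)%N.

Lemma natsqrt_floor n : (Nat.sqrt n * Nat.sqrt n <= n)%N.
Proof. by apply/ssrnat.leP; have [] := Nat.sqrt_spec n (Nat.le_0_l n). Qed.

Lemma natsqrt_ceil n : (n < (Nat.sqrt n).+1 * (Nat.sqrt n).+1)%N.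
Proof. by apply/ssrnat.ltP; have [] := Nat.sqrt_spec n (Nat.le_0_l n). Qed.

Lemma natsqrt_gt0 n : (0 < n)%N -> (0 < Nat.sqrt n)%N.
Proof. by have := natsqrt_ceil n; case: (Nat.sqrt n) => // ; case: n => [|[]]. Qed.

Lemma natsqrt_le_sqrt n : (Nat.sqrt n)%:R <= Num.sqrt (n%:R : R).
Proof.
rewrite -(ler_pXn2r (n := 2)) ?nnegrE ?sqrtr_ge0 ?ler0n //.
by rewrite sqr_sqrtr ?ler0n // -natrX ler_nat -mulnn natsqrt_floor.
Qed.

(** [up_log 2 n - 1] is below the binary logarithm, and its double reaches [up_log 2 n] once the
    latter is at least 2. *)
Lemma up_log2_le_ln n : (2 < n)%N ->
  (up_log 2 n)%:R * ln 2 <= 2 * ln (n%:R : R).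
Proof.
move=> n_gt2; have n_gt1 : (1 < n)%N by apply: ltnW.
have l_gt1 : (1 < up_log 2 n)%N.
  by rewrite ltnNge; apply: contraL n_gt2 => h; rewrite -leqNgt
     (leq_trans (up_logP n (isT : 1 < 2)%N)) // (leq_pexp2l _ h).
have ln2_ge0 : 0 <= ln 2 :> R by rewrite ln_ge0 // ler1n.
have : (up_log 2 n).-1%:R * ln 2 <= ln (n%:R : R).
  rewrite mulr_natl -lnXn ?ltr0n // ler_ln ?posrE ?exprn_gt0 ?ltr0n //; last lia.
  by rewrite -natrX ler_nat ltnW // up_log_gtn.
have : (up_log 2 n)%:R * ln 2 <= (2 * (up_log 2 n).-1)%:R * ln 2 :> R.
  by rewrite ler_wpM2r // ler_nat; lia.
rewrite natrM -mulrA => h1 h2; apply: le_trans h1 _.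
by rewrite ler_wpM2l.
Qed.

Lemma softO_apsp_rounds :
  softO (fun n => (apsp_rounds n)%:R : R) (fun n => Num.sqrt (n%:R : R)).
Proof.
exists 1%N; apply/eqO_exP.
have ln2_gt0 : 0 < ln 2 :> R by rewrite ln_gt0 // ltr1n.
(* 24 is [4 * 2 * 3]: the count is [4 * up_log 2 n * (m + 2)] with [m = Nat.sqrt n], where
   [up_log 2 n <= 2 * ln n / ln 2] and [m + 2 <= 3 * sqrt n]. *)
exists (24 / ln 2) => //; first by rewrite divr_gt0.
near=> n.
have n_gt2 : (2 < n)%N by near: n; exists 3%N.
have lnn_ge0 : 0 <= ln (n%:R : R) by rewrite ln_ge0 // ler1n; lia.
rewrite expr1 !ger0_norm ?mulr_ge0 ?sqrtr_ge0 ?ler0n //.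
have s1 : 1 <= Num.sqrt (n%:R : R).
  by rewrite -[leLHS]sqrtr1 ler_wsqrtr // ler1n; lia.
have -> : (apsp_rounds n)%:R =
    4 * (up_log 2 n)%:R * ((Nat.sqrt n)%:R + 2) :> R.
  by rewrite /apsp_rounds -!muln2 !natrM -addn2 natrD; ring.
have sle := natsqrt_le_sqrt n; have lle := up_log2_le_ln n_gt2.
have -> : 24 / ln 2 * (Num.sqrt n%:R * ln n%:R) =
    4 * ((2 * ln n%:R) / ln 2) * (3 * Num.sqrt n%:R) :> R by ring.
apply: ler_pM; rewrite ?mulr_ge0 ?addr_ge0 ?ler0n //; last by lra.
by rewrite ler_wpM2l // ler_pdivlMr.
Unshelve. all: by end_near.
Qed.

End Bounds.

(** * The algorithm for each [n], with [m = Nat.sqrt n] *)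

Section APSP.
Local Open Scope nat_scope.
Variables (X O : Type) (beta : nat) (idmax : nat -> nat).
Variable pout : X -> mpstate -> O.

Definition apsp_algorithm : congest_algorithm X O beta := fun n =>
  @exchange_algorithm X O mpstate (beta * up_log 2 n) ((Nat.sqrt n).+2).*2
    (mpinit (idmax n)) (mpsend (Nat.sqrt n)) (mprecv (Nat.sqrt n)) pout.

Definition default_coins n : coins n (apsp_algorithm n) := [ffun=> [tuple]].

Lemma run_apsp n wmax (N : network n (idmax n) wmax) x r :
    fully_connected N -> 1 < n -> wmax < 2 ^ (beta * up_log 2 n) ->
  exists st : 'I_n -> mpstate,
    (forall v, run N x (apsp_rounds n) (r : coins n (apsp_algorithm n)) v =
               pout x (st v)) /\
    forall v u, entry (st v) (nid N u) = mpdist N (up_log 2 n) v u.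
Proof.
move=> fcN n_gt1 wB; eexists; split=> [v|v u]; first exact: run_exchange.
by have [] := iter_exchange_mpdist fcN wB (natsqrt_gt0 (ltnW n_gt1))
  (natsqrt_floor n) (natsqrt_ceil n) (up_log 2 n) v.
Qed.

End APSP.

(** [C < n ^ C] moves the constant factor into the exponent. It is applied to the weights only, as
    identifiers are never sent. *)
Lemma message_bound (f : nat -> nat) : poly_bounded f ->
  exists beta, forall n, (1 < n)%N -> (f n < 2 ^ (beta * up_log 2 n))%N.
Proof.
move=> [C [a fP]]; exists (C + a)%N => n n_gt1.
apply: leq_ltn_trans (fP n (ltnW n_gt1)) _.
rewrite [X in (_ < 2 ^ X)%N]mulnC expnM.
apply: (@leq_trans (n ^ (C + a))); last first.
  by case: (C + a)%N => // e; rewrite leq_exp2r // up_logP.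
rewrite expnD ltn_pmul2r ?expn_gt0 ?(ltnW n_gt1) //.
exact: ltn_expl.
Qed.

Local Open Scope classical_set_scope.
Local Open Scope ring_scope.

Theorem theorem1p5 (R : realType) (idmax wmax : nat -> nat)
    (hid : poly_bounded idmax) (hwt : poly_bounded wmax) :
  exists beta : nat,
    (forall c : nat,
      exists (T : nat -> nat) (A : congest_algorithm nat nat beta),
        softO (fun n => (T n)%:R : R) (fun n => Num.sqrt (n%:R : R)) /\
        forall (n : nat) (N : network n (idmax n) (wmax n)) (s : 'I_n),
          fully_connected N ->
          1 - (n%:R ^+ c)^-1 <=
            Pr R (fun r : coins n (A n) =>
                    solves_SSSP R N s (run N (nid N s) (T n) r)))
    /\
    (exists eps : nat -> R,
      eps @ \oo --> (0 : R) /\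
      forall c : nat,
      exists (T : nat -> nat) (A : congest_algorithm unit (nat -> R) beta),
        softO (fun n => (T n)%:R : R) (fun n => Num.sqrt (n%:R : R)) /\
        forall (n : nat) (N : network n (idmax n) (wmax n)),
          (0 < n)%N -> fully_connected N ->
          1 - (n%:R ^+ c)^-1 <=
            Pr R (fun r : coins n (A n) =>
                    approximates_APSP N (2 + eps n) (run N tt (T n) r))).
Proof.
have [beta wB] := message_bound hwt; exists beta; split=> [c|].
  (* Both problems run the same exchanges and differ in what is read off the final row. *)
  exists apsp_rounds, (apsp_algorithm beta idmax (fun x st => entry st x)).
  split=> [|n N s fcN]; first exact: softO_apsp_rounds.
  apply: Pr_whp => [||n_gt1 r v]; first exact: default_coins.
    exact: leq_ltn_trans (ltn_ord s).
  have [st [-> ->]] := run_apsp (nid N s) r fcN n_gt1 (wB _ n_gt1).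
  by rewrite mpdist_sym // mpdist_dist ?up_logP.
(* The distances found are exact, so no error term is needed. *)
exists (fun=> 0); split=> [|c]; first exact: cvg_cst.
exists apsp_rounds.
exists (apsp_algorithm beta idmax (fun _ st i => (entry st i)%:R)).
split=> [|n N n_gt0 fcN]; first exact: softO_apsp_rounds.
apply: Pr_whp => // [|n_gt1 r]; first exact: default_coins.
have [st [outE rowE]] := run_apsp tt r fcN n_gt1 (wB _ n_gt1).
exists (fun u v => (mpdist N (up_log 2 n) u v)%:R) => u v.
have distE := mpdist_dist fcN R u v (up_logP n (isT : (1 < 2)%N)).
split; rewrite ?outE ?rowE ?[mpdist _ _ v u]mpdist_sym // -distE //.
by rewrite -EFinM lee_fin addr0 mulr_natl mulr2n lerDl.
Qed.
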